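(* Let $\mathbb{D}$ be the open unit disc in $\mathbb{C}$. There exist a Banach space $X\hookrightarrow\mathrm{Hol}(\mathbb{D})$ and $G\in\mathrm{Hol}(\mathbb{D})$ such that the operator $A$ on $X$ defined by $$D(A):=\{f\in X: Gf'\in X\},\qquad Af=Gf'$$ generates a $C_0$-semigroup $T$ on $X$, but $T$ does not consist of composition operators.
   Context: $\mathrm{Hol}(\mathbb{D})$ is the Fréchet space of all holomorphic functions $\mathbb{D}\to\mathbb{C}$ (uniform convergence on compact sets). $X\hookrightarrow\mathrm{Hol}(\mathbb{D})$ means: $X$ is a linear subspace of $\mathrm{Hol}(\mathbb{D})$ which is a complex Banach space for its own norm $\|\cdot\|_X$, and for every $z\in\mathbb{D}$ the evaluation $f\mapsto f(z)$ is a bounded linear functional on $X$ (equivalently, the embedding of $X$ in $\mathrm{Hol}(\mathbb{D})$ is continuous). $T$ consists of composition operators if for every $t\ge 0$ there is a holomorphic map $\varphi_t:\mathbb{D}\to\mathbb{D}$ such that $T(t)f=f\circ\varphi_t$ for all $f\in X$. *)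

(* Defs.v *)
From Stdlib Require Import Reals.
From Coquelicot Require Import Coquelicot.
Open Scope R_scope.

Definition unit_disc (z : C) : Prop := Cmod z < 1.

(* An element of Hol(D) is represented by a function C -> C that is complex
   differentiable at every point of D; its values outside D are irrelevant, and
   two such functions are the same element iff they agree on D. *)
Definition holomorphic_on_disc (f : C -> C) : Prop :=
  forall z : C, unit_disc z -> @ex_derive C_AbsRing C_NormedModule f z.

(* X embedded in Hol(D): a complex Banach space whose vectors are identified,
   through the injection [hol_fun], with holomorphic functions on D.
   [is_linear] is Coquelicot's notion of bounded linear map; linearity of the
   point evaluations says that the vector space operations of X are those of
   Hol(D), so that X is a linear subspace of Hol(D) with a norm of its own. *)
Record BanachInHol := {
  banach_space :> CompleteNormedModule C_AbsRing;
  hol_fun : banach_space -> C -> C;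
  hol_fun_holomorphic : forall f : banach_space,
    holomorphic_on_disc (hol_fun f);
  hol_fun_injective : forall f g : banach_space,
    (forall z : C, unit_disc z -> hol_fun f z = hol_fun g z) -> f = g;
  hol_fun_eval : forall z : C, unit_disc z ->
    @is_linear C_AbsRing banach_space C_NormedModule (fun f => hol_fun f z)
}.

(* Only the values T t with 0 <= t are meaningful. *)
Record is_C0_semigroup (X : CompleteNormedModule C_AbsRing)
    (T : R -> X -> X) : Prop := {
  C0_bounded : forall t : R, 0 <= t -> is_linear (T t);
  C0_zero : forall f : X, T 0 f = f;
  C0_plus : forall (s t : R) (f : X),
    0 <= s -> 0 <= t -> T (s + t) f = T s (T t f);
  C0_continuous : forall f : X,
    filterlim (fun t : R => T t f) (at_right 0) (locally f)
}.

(* Unbounded operators are represented by their graphs: [A f g] means that f is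
   in the domain D(A) and that A f = g. *)
Definition generator (X : CompleteNormedModule C_AbsRing) (T : R -> X -> X)
    (f g : X) : Prop :=
  filterlim (fun h : R => scal (RtoC (/ h)) (minus (T h f) f))
    (at_right 0) (locally g).

Definition generates (X : CompleteNormedModule C_AbsRing)
    (A : X -> X -> Prop) (T : R -> X -> X) : Prop :=
  is_C0_semigroup X T /\ forall f g : X, A f g <-> generator X T f g.

(* The graph of f |-> G f' on {f in X : G f' in X}. *)
Definition weighted_derivation (X : BanachInHol) (G : C -> C) (f g : X) : Prop :=
  forall z : C, unit_disc z ->
    hol_fun X g z = (G z * C_derive (hol_fun X f) z)%C.

Definition consists_of_composition_operators (X : BanachInHol)
    (T : R -> X -> X) : Prop :=
  forall t : R, 0 <= t ->
    exists phi : C -> C,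
      holomorphic_on_disc phi /\
      (forall z : C, unit_disc z -> unit_disc (phi z)) /\
      forall (f : X) (z : C), unit_disc z ->
        hol_fun X (T t f) z = hol_fun X f (phi z).

(* Main.v *)
Require Import Defs.
From Stdlib Require Import Reals Lra.
From Coquelicot Require Import Coquelicot.
Open Scope R_scope.

(** The phenomenon already occurs in dimension one.  Let [X] be the line spanned
    by the identity function [z] and let [G z = z].  Then [G f' = f] for every
    [f] in [X], so the domain of [A] is all of [X] and [A] is the identity
    operator, which generates [T t f = exp t * f].  The flow of the vector field
    [G] is [z |-> exp t * z]; it leaves the disc, and this is what prevents [T]
    from being made of composition operators: since [X] contains the identity
    function, a symbol [phi] of [T t] has to be [T t z = exp t * z], which for
    [t = 1] sends [1/2] to [exp 1 / 2 > 1].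

    The analytic content is [expm1_quotient_at_right], the derivative of the
    exponential at [0], from which [scalar_exp_generator] identifies the
    generator of [T] as the identity operator; [weighted_derivation_line] shows
    that [A] is the identity operator as well. *)

Lemma C_is_linear_mult_l (k : C) :
  @is_linear C_AbsRing C_NormedModule C_NormedModule (fun f => (k * f)%C).
Proof.
exact (@is_linear_scal_r C_AbsRing C_NormedModule k Cmult_comm).
Qed.

Lemma is_derive_mult_const (c z : C) :
  @is_derive C_AbsRing C_NormedModule (fun w => (w * c)%C) z c.
Proof.
pose proof (@is_derive_scal_l C_AbsRing C_NormedModule (fun w => w) z (RtoC 1) c
              (is_derive_id (K := C_AbsRing) z)) as Hd.
assert (Hc : @scal C_AbsRing C_NormedModule (RtoC 1) c = c) by apply Cmult_1_l.
rewrite Hc in Hd; exact Hd.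
Qed.

(** Any nonzero point of the disc determines a multiple of the identity
    function; this one also is far enough from [0] to be moved out of the disc
    by the factor [exp 1]. *)
Definition half : C := RtoC (/ 2).

Lemma half_in_disc : unit_disc half.
Proof.
unfold unit_disc, half; rewrite Cmod_R, Rabs_pos_eq; lra.
Qed.

Lemma half_mult_inj (c d : C) : (half * c)%C = (half * d)%C -> c = d.
Proof.
assert (Hhalf : (2 * half)%C = 1%C).
{ unfold half; rewrite <- RtoC_mult; f_equal; lra. }
intros H.
rewrite <- (Cmult_1_l c), <- (Cmult_1_l d), <- Hhalf, <- !Cmult_assoc, H.
reflexivity.
Qed.

Definition identity_line : BanachInHol.
Proof.
refine (Build_BanachInHol C_CompleteNormedModule
          (fun c z => (z * c)%C) _ _ _).
- intros c z _; exists c; apply is_derive_mult_const.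
- intros c d H; apply half_mult_inj, H, half_in_disc.
- intros z _; apply C_is_linear_mult_l.
Defined.

(** The identity function is an eigenvector of [f |-> z f'] for the
    eigenvalue [1]. *)
Lemma weighted_derivation_line (f g : identity_line) :
  weighted_derivation identity_line (fun z => z) f g <-> g = f.
Proof.
assert (Hd : forall z, C_derive (hol_fun identity_line f) z = f).
{ intros z; apply is_C_derive_unique, is_derive_mult_const. }
split.
- intros H; apply half_mult_inj.
  rewrite <- (Hd half) at 1; exact (H half half_in_disc).
- intros -> z _; rewrite Hd; reflexivity.
Qed.

Definition scalar_exp (t : R) (f : C_CompleteNormedModule) :
  C_CompleteNormedModule := (RtoC (exp t) * f)%C.

(** The topology of [C] is the same for real and for complex scalars, so a real
    limit can be transported by continuity of the real scalar multiplication. *)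
Lemma filterlim_RtoC_mult (F : (R -> Prop) -> Prop) {FF : Filter F}
  (u : R -> R) (l : R) (f : C) :
  filterlim u F (locally l) ->
  filterlim (fun h => (RtoC (u h) * f)%C) F
    (@locally C_UniformSpace (RtoC l * f)%C).
Proof.
intros Hu; rewrite <- scal_R_Cmult.
apply (filterlim_ext (fun h => @scal R_AbsRing C_R_NormedModule (u h) f)).
- intros h; apply scal_R_Cmult.
- exact (filterlim_comp _ _ _ u _ F _ _ Hu
           (@filterlim_scal_l R_AbsRing C_R_NormedModule l f)).
Qed.

Lemma expm1_quotient_at_right :
  filterlim (fun h => (exp h - 1) / h) (at_right 0) (locally 1).
Proof.
apply (filterlim_filter_le_1 (F := locally' 0)).
- unfold at_right, locally', within; intros P.
  apply filter_imp; intros h HP Hh; apply HP; lra.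
- exact is_lim_div_expm1_0.
Qed.

Lemma scalar_exp_C0 : is_C0_semigroup C_CompleteNormedModule scalar_exp.
Proof.
unfold scalar_exp; split.
- intros t _; apply C_is_linear_mult_l.
- intros f; rewrite exp_0; apply Cmult_1_l.
- intros s t f _ _; rewrite exp_plus, RtoC_mult; symmetry; apply Cmult_assoc.
- intros f.
  rewrite <- (Cmult_1_l f) at 1; rewrite <- exp_0.
  apply (filterlim_RtoC_mult (at_right 0)).
  apply (filterlim_filter_le_1 (F := locally 0)).
  + apply filter_le_within.
  + apply ElemFct.continuous_exp.
Qed.

Lemma scalar_exp_generator (f g : C_CompleteNormedModule) :
  generator C_CompleteNormedModule scalar_exp f g <-> g = f.
Proof.
assert (Hf : generator C_CompleteNormedModule scalar_exp f f).
{ unfold generator.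
  apply (filterlim_ext (fun h => (RtoC ((exp h - 1) / h) * f)%C)).
  - intros h; unfold Rdiv; rewrite RtoC_mult, RtoC_minus.
    change ((RtoC (exp h) - 1) * RtoC (/ h) * f
            = RtoC (/ h) * (RtoC (exp h) * f - f))%C.
    ring.
  - rewrite <- (Cmult_1_l f) at 1.
    apply (filterlim_RtoC_mult (at_right 0)), expm1_quotient_at_right. }
split.
- intros Hg; exact (filterlim_locally_unique _ _ _ Hg Hf).
- intros ->; exact Hf.
Qed.

Theorem proposition3p8 :
  exists (X : BanachInHol) (G : C -> C) (T : R -> X -> X),
    holomorphic_on_disc G /\
    generates X (weighted_derivation X G) T /\
    ~ consists_of_composition_operators X T.
Proof.
exists identity_line, (fun z => z), scalar_exp.
split; [| split].
- intros z Hz.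
  exact (ex_derive_ext _ _ z Cmult_1_r
           (hol_fun_holomorphic identity_line (RtoC 1) z Hz)).
- split; [exact scalar_exp_C0 |].
  intros f g; rewrite weighted_derivation_line.
  symmetry; apply scalar_exp_generator.
- intros Hcomp.
  destruct (Hcomp 1 Rle_0_1) as (phi & _ & Hmap & Hphi).
  (* the coordinate 1 is the identity function itself *)
  specialize (Hphi (RtoC 1) half half_in_disc).
  specialize (Hmap half half_in_disc).
  cbn in Hphi; unfold scalar_exp in Hphi.
  rewrite !Cmult_1_r in Hphi.
  unfold unit_disc in Hmap; rewrite <- Hphi in Hmap.
  unfold half in Hmap.
  rewrite <- RtoC_mult, Cmod_R in Hmap.
  pose proof (Rle_abs (/ 2 * exp 1)).
  assert (1 + 1 < exp 1) by (apply exp_ineq1; lra).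
  lra.
Qed.
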